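(* Let $N=(P,T,F,\alpha,\beta)$ be a typed Jackson Net (t-JN) in which every place type is non-empty, and let $N'=\biguplus_{\emptyset\subset\Upsilon\subseteq \mathrm{type}_\Lambda(N)}\pi_\Upsilon(N)$ be the composition of the type projections of $N$ on all non-empty sets $\Upsilon$ of types occurring in $N$. Then the transition systems induced by $N$ and $N'$ from their empty markings are rooted strongly bisimilar: $\Gamma_{N,\emptyset}\sim^r\Gamma_{N',\emptyset}$.
   Context: **Typed Petri nets with identifiers.** Fix countably infinite sets $\mathcal I$ (identifiers), $\Lambda$ (type labels), $\mathcal V$ (variables). Each $\lambda\in\Lambda$ has an infinite domain $I(\lambda)\subseteq\mathcal I$; domains of distinct types are disjoint. Each identifier $id$ has a type with $id\in I(\mathrm{type}(id))$, and each variable has a type. A t-PNID is $N=(P,T,F,\alpha,\beta)$ where $P,T$ are disjoint sets of places and transitions, $F\subseteq (P\times T)\cup(T\times P)$, $\alpha:P\to\Lambda^*$ is the place typing, and $\beta$ assigns to each arc a finite multiset of variable vectors such that each vector on an arc adjacent to $p$ has type $\alpha(p)$. ${}^\bullet x$ and $x^\bullet$ denote presets and postsets. A marking $m$ assigns to each place $p$ a finite multiset over $C(p)=\prod_i I(\alpha(p)(i))$; $\emptyset$ is the empty marking; $\mathrm{Id}(m)$ is the set of identifiers occurring in $m$. $In(t)$ / $Out(t)$ are the sets of variables on input / output arcs of $t$, $Var(t)=In(t)\cup Out(t)$, $Emit(t)=Out(t)\setminus In(t)$. $\mathrm{type}_\Lambda(N)$ is the set of all types occurring in some $\alpha(p)$.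 A binding for $t$ in $m$ is an injective type-preserving map $\psi:Var(t)\to\mathcal I$ with $\psi(v)\notin \mathrm{Id}(m)$ iff $v\in Emit(t)$. $t$ is enabled in $m$ under $\psi$ iff $\psi(\beta(p,t))\le m(p)$ for all $p\in{}^\bullet t$ ($\psi$ applied componentwise to vectors and elementwise to multisets); firing gives $m'$ with $m'(p)+\psi(\beta(p,t))=m(p)+\psi(\beta(t,p))$ for all $p$ (with $\beta$ of a non-arc empty). $\Gamma_{N,m_0}$ is the labelled transition system whose states are the markings of $N$, with initial state $m_0$, and $m\xrightarrow{(t,\psi)}m'$ iff firing $t$ under $\psi$ in $m$ gives $m'$. $\Gamma_1\sim^r\Gamma_2$ means there is a relation $R$ between states that relates the initial states and is a strong bisimulation (each transition of one side is matched by an equally labelled transition of the other side, leading to related states). **Typed Jackson Nets.** Here variables and types are in bijection, place types are finite sets of types (ordered as vectors by a fixed total order on types), and each arc adjacent to a place $p$ is inscribed with the single vector consisting of exactly the variables of the types in $\alpha(p)$, each once. Variables are identified with their types, e.g. in $Var(t)\subseteq\lambda$. $[p,\lambda]$ denotes a place $p$ with $\alpha(p)=\lambda$. A t-PNID is a t-JN if it can be generated from a set of transitions (with no places) by repeatedly applying the following rules (new nodes are fresh): - R1: replace a place $[p,\lambda]$ by $[p_1,\lambda]\to t_1\to[p_2,\lambda]$, where $p_1$ inherits the incoming arcs and $p_2$ the outgoing arcs of $p$. - R2: replace a transition $t$ by $t_1\to[p,\lambda]\to t_2$ with $Var(t)\subseteq\lambda$, where $t_1$ inherits the incoming arcs and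 $t_2$ the outgoing arcs of $t$. - R3: if ${}^\bullet p=\{t_1\}$ and $p^\bullet=\{t_2\}$, add a place $[p',\lambda']$ with ${}^\bullet p'=\{t_1\}$, $p'^\bullet=\{t_2\}$, where $\lambda'\cap Emit(t_2)=\emptyset$. - R4: add a transition $t'$ with the same presets, postsets and inscriptions as an existing transition $t$. - R5: for a place $p$, add a transition $t$ with ${}^\bullet t=t^\bullet=\{p\}$. - R6: for a transition $t$, add a disjoint t-JN of the form $N_1;([p,\lambda];N_2)$ (its place $p$ of type $\lambda$ separates it into $N_1$ and $N_2$; all arcs into $p$ come from transitions of $N_1$, all arcs out of $p$ go to transitions of $N_2$) with $\lambda\cap Var(t)=\emptyset$, together with arcs $(t,p)$ and $(p,t)$. **Type projection.** For $\Upsilon\subseteq\Lambda$, $\pi_\Upsilon(N)=(P_\Upsilon,T_\Upsilon,F_\Upsilon,\alpha_\Upsilon,\beta_\Upsilon)$ with $P_\Upsilon=\{p\in P\mid \Upsilon\subseteq\alpha(p)\}$, $T_\Upsilon=\{t\in T\mid({}^\bullet t\cup t^\bullet)\cap P_\Upsilon\ne\emptyset\}$, $F_\Upsilon=F\cap((P_\Upsilon\times T_\Upsilon)\cup(T_\Upsilon\times P_\Upsilon))$, $\alpha_\Upsilon(p)=\Upsilon$, and $\beta_\Upsilon(f)$ is $\beta(f)$ with vectors restricted to variables with type in $\Upsilon$. **Composition.** $N\uplus M$ is the componentwise union of the places, transitions, arcs, typings and inscriptions of $N$ and $M$. In compositions of projections, transitions are shared (identified by name), while the copies of a place $p$ in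 different projections $\pi_\Upsilon(N)$ are distinct places $(p,\Upsilon)$.
   Formalization: It is additionally assumed that every transition of N has at least one adjacent place; a t-JN with an isolated transition can fire it from the empty marking, but that transition occurs in no projection, so the claim fails for such nets. *)

(* Defs.v *)
From mathcomp Require Import all_boot all_order.
From mathcomp Require Import finmap multiset.
From mathcomp Require Import boolp classical_sets functions cardinality.

Set Implicit Arguments.
Unset Strict Implicit.
Unset Printing Implicit Defensive.

Import Order.TTheory.
Local Open Scope classical_set_scope.
Local Open Scope card_scope.

Section LabelledTransitionSystems.

Record lts (A : Type) : Type := Lts {
  state : Type;
  init : state;
  step : state -> A -> state -> Prop }.

Definition strong_bisimulation (A : Type) (G1 G2 : lts A)
    (R : state G1 -> state G2 -> Prop) : Prop :=
  forall s1 s2, R s1 s2 ->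
    (forall a s1', step s1 a s1' -> exists2 s2', step s2 a s2' & R s1' s2') /\
    (forall a s2', step s2 a s2' -> exists2 s1', step s1 a s1' & R s1' s2').

Definition rooted_bisimilar (A : Type) (G1 G2 : lts A) : Prop :=
  exists2 R : state G1 -> state G2 -> Prop,
    R (init G1) (init G2) & strong_bisimulation R.

End LabelledTransitionSystems.

(* The fixed sets of type labels (with the total order that is used to write a
   set of types as a vector), identifiers and variables.  The domain I(l) of a
   label l is the fibre of idtype over l (see [dom]); hence id is in
   I(type(id)), and domains of distinct labels are disjoint. *)
Record signature : Type := Signature {
  label_disp : Order.disp_t;
  label : orderType label_disp;
  ident : choiceType;
  var : choiceType;
  idtype : ident -> label;
  vartype : var -> label;
  label_countable : [set: label] #= [set: nat];
  ident_countable : [set: ident] #= [set: nat];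
  var_countable : [set: var] #= [set: nat];
  dom_infinite : forall l, infinite_set [set x | idtype x = l] }.

Definition dom (S : signature) (l : label S) : set (ident S) :=
  [set x | idtype x = l].

Definition mset_map (A B : choiceType) (f : A -> B) (X : {mset A}%mset) :
    {mset B}%mset :=
  seq_mset [seq f x | x <- (X : seq A)].

(* P and T are carriers of node names, so places and transitions are disjoint
   by typing.  F is split into its two halves.  [alpha] is meaningful only on
   places, and [beta_pt], [beta_tp] only on arcs (see [inscr_pt]). *)
Record tpnid (S : signature) (P T : Type) : Type := TPnid {
  places : set P;
  trans : set T;
  pt : set (P * T);
  tp : set (T * P);
  alpha : P -> seq (label S);
  beta_pt : P -> T -> {mset (seq (var S))}%mset;
  beta_tp : T -> P -> {mset (seq (var S))}%mset }.

Section Nets.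
Context {S : signature} {P T : Type}.
Implicit Types (N M : tpnid S P T) (p : P) (t : T).

Definition wf_tpnid N : Prop :=
  [/\ pt N `<=` places N `*` trans N,
      tp N `<=` trans N `*` places N,
      forall p t, pt N (p, t) -> forall vs, vs \in beta_pt N p t ->
        [seq vartype v | v <- vs] = alpha N p
    & forall p t, tp N (t, p) -> forall vs, vs \in beta_tp N t p ->
        [seq vartype v | v <- vs] = alpha N p].

(* beta, extended by the empty multiset on non-arcs *)
Definition inscr_pt N p t : {mset (seq (var S))}%mset :=
  if (p, t) \in pt N then beta_pt N p t else mset0.

Definition inscr_tp N t p : {mset (seq (var S))}%mset :=
  if (t, p) \in tp N then beta_tp N t p else mset0.

Definition In N t : set (var S) :=
  [set v | exists p vs, vs \in inscr_pt N p t /\ v \in vs].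

Definition Out N t : set (var S) :=
  [set v | exists p vs, vs \in inscr_tp N t p /\ v \in vs].

Definition Var N t : set (var S) := In N t `|` Out N t.

Definition Emit N t : set (var S) := Out N t `\` In N t.

Definition types N : set (label S) :=
  [set l | exists2 p, places N p & l \in alpha N p].

(* C(p): vectors of identifiers whose i-th entry lies in I(alpha(p)(i)) *)
Definition colour N p : set (seq (ident S)) :=
  [set xs | size xs = size (alpha N p) /\
    forall x0 l0 i, (i < size xs)%N ->
      dom (nth l0 (alpha N p) i) (nth x0 xs i)].

(* Tokens outside the places of N are excluded, so that markings are compared
   by plain equality of functions. *)
Definition is_marking N (m : P -> {mset (seq (ident S))}%mset) : Prop :=
  forall p xs, xs \in m p -> places N p /\ colour N p xs.

Definition marking N : Type := {m | is_marking N m}.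

Lemma is_marking_empty N : is_marking N (fun=> mset0).
Proof. by move=> p xs; rewrite in_mset0. Qed.

Definition empty_marking N : marking N := exist _ _ (@is_marking_empty N).

Definition Id (m : P -> {mset (seq (ident S))}%mset) : set (ident S) :=
  [set x | exists p xs, xs \in m p /\ x \in xs].

(* A map psi : Var(t) -> identifiers is a partial function on variables whose
   domain is exactly Var(t). *)
Definition valuation : Type := var S -> option (ident S).

Definition is_binding N t (m : P -> {mset (seq (ident S))}%mset)
    (psi : valuation) : Prop :=
  [/\ forall v, Var N t v <-> exists x, psi v = Some x,
      forall v w x, psi v = Some x -> psi w = Some x -> v = w,
      forall v x, psi v = Some x -> idtype x = vartype v
    & forall v x, psi v = Some x -> (~ Id m x <-> Emit N t v)].

(* psi(X); [pmap] acts as a componentwise [map] on vectors over the domain of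
   psi, which are the only ones that occur in inscriptions on arcs of t. *)
Definition inst (psi : valuation) (X : {mset (seq (var S))}%mset) :
    {mset (seq (ident S))}%mset :=
  mset_map (pmap psi) X.

Definition enabled N t (psi : valuation)
    (m : P -> {mset (seq (ident S))}%mset) : Prop :=
  forall p, pt N (p, t) -> (inst psi (inscr_pt N p t) `<=` m p)%mset.

Definition fires N (m : marking N) (a : T * valuation) (m' : marking N) : Prop :=
  let: (t, psi) := a in
  [/\ trans N t, is_binding N t (sval m) psi, enabled N t psi (sval m)
    & forall p, (sval m' p `+` inst psi (inscr_pt N p t) =
                 sval m p `+` inst psi (inscr_tp N t p))%mset].

Definition Gamma N (m0 : marking N) : lts (T * valuation) :=
  Lts m0 (@fires N).

End Nets.

Definition tvec (S : signature) (U : {fset (label S)}%fset) : seq (label S) :=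
  sort <=%O (U : seq (label S)).

Section TypedJacksonNets.
Context {S : signature} {P T : Type}.
Implicit Types (N M : tpnid S P T) (U : {fset (label S)}%fset).

(* Since variables and types are in bijection, the vector vs below is the
   vector of the variables of the types in alpha(p). *)
Definition jn_inscribed N : Prop :=
  [/\ forall p, places N p -> exists U, alpha N p = tvec U,
      forall p t, pt N (p, t) -> exists2 vs,
        [seq vartype v | v <- vs] = alpha N p & beta_pt N p t = [mset vs]%mset
    & forall p t, tp N (t, p) -> exists2 vs,
        [seq vartype v | v <- vs] = alpha N p & beta_tp N t p = [mset vs]%mset].

(* N is of the form N1;([p,U];N2), where N1 and N2 have nodes P1, T1 and
   P2, T2. *)
Definition separates N (p : P) : Prop :=
  exists (P1 P2 : set P) (T1 T2 : set T),
    [/\ places N = P1 `|` [set p] `|` P2 /\ trans N = T1 `|` T2,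
        ~ P1 p /\ ~ P2 p,
        P1 `&` P2 = set0 /\ T1 `&` T2 = set0,
        pt N `<=` P1 `*` T1 `|` P2 `*` T2 `|` [set p] `*` T2
      & tp N `<=` T1 `*` P1 `|` T2 `*` P2 `|` T1 `*` [set p]].

(* Each rule fixes the nodes, arcs and place types of the resulting net N'; its
   inscriptions are then determined by [jn_inscribed N']. *)
Inductive tJN : tpnid S P T -> Prop :=
| tJN_transitions N of wf_tpnid N & jn_inscribed N & places N = set0 : tJN N
| tJN_R1 N N' p p1 p2 t1 of tJN N & wf_tpnid N' & jn_inscribed N' :
    places N p ->
    ~ places N p1 -> ~ places N p2 -> p1 <> p2 -> ~ trans N t1 ->
    places N' = places N `\ p `|` [set p1; p2] ->
    trans N' = trans N `|` [set t1] ->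
    pt N' = [set a | pt N a /\ a.1 <> p]
            `|` [set (p2, t) | t in [set t | pt N (p, t)]]
            `|` [set (p1, t1)] ->
    tp N' = [set a | tp N a /\ a.2 <> p]
            `|` [set (t, p1) | t in [set t | tp N (t, p)]]
            `|` [set (t1, p2)] ->
    (forall q, places N q -> q <> p -> alpha N' q = alpha N q) ->
    alpha N' p1 = alpha N p -> alpha N' p2 = alpha N p ->
    tJN N'
| tJN_R2 N N' t t1 t2 p U of tJN N & wf_tpnid N' & jn_inscribed N' :
    trans N t ->
    (forall v, Var N t v -> vartype v \in U) ->
    ~ trans N t1 -> ~ trans N t2 -> t1 <> t2 -> ~ places N p ->
    places N' = places N `|` [set p] ->
    trans N' = trans N `\ t `|` [set t1; t2] ->
    pt N' = [set a | pt N a /\ a.2 <> t]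
            `|` [set (q, t1) | q in [set q | pt N (q, t)]]
            `|` [set (p, t2)] ->
    tp N' = [set a | tp N a /\ a.1 <> t]
            `|` [set (t2, q) | q in [set q | tp N (t, q)]]
            `|` [set (t1, p)] ->
    (forall q, places N q -> alpha N' q = alpha N q) ->
    alpha N' p = tvec U ->
    tJN N'
| tJN_R3 N N' p t1 t2 p' U of tJN N & wf_tpnid N' & jn_inscribed N' :
    places N p ->
    [set t | tp N (t, p)] = [set t1] -> [set t | pt N (p, t)] = [set t2] ->
    (forall v, Emit N t2 v -> vartype v \notin U) ->
    ~ places N p' ->
    places N' = places N `|` [set p'] ->
    trans N' = trans N ->
    pt N' = pt N `|` [set (p', t2)] ->
    tp N' = tp N `|` [set (t1, p')] ->
    (forall q, places N q -> alpha N' q = alpha N q) ->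
    alpha N' p' = tvec U ->
    tJN N'
| tJN_R4 N N' t t' of tJN N & wf_tpnid N' & jn_inscribed N' :
    trans N t -> ~ trans N t' ->
    places N' = places N ->
    trans N' = trans N `|` [set t'] ->
    pt N' = pt N `|` [set (q, t') | q in [set q | pt N (q, t)]] ->
    tp N' = tp N `|` [set (t', q) | q in [set q | tp N (t, q)]] ->
    (forall q, places N q -> alpha N' q = alpha N q) ->
    tJN N'
| tJN_R5 N N' p t of tJN N & wf_tpnid N' & jn_inscribed N' :
    places N p -> ~ trans N t ->
    places N' = places N ->
    trans N' = trans N `|` [set t] ->
    pt N' = pt N `|` [set (p, t)] ->
    tp N' = tp N `|` [set (t, p)] ->
    (forall q, places N q -> alpha N' q = alpha N q) ->
    tJN N'
| tJN_R6 N M N' t p U of tJN N & tJN M & wf_tpnid N' & jn_inscribed N' :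
    trans N t ->
    places N `&` places M = set0 -> trans N `&` trans M = set0 ->
    places M p -> alpha M p = tvec U -> separates M p ->
    (forall v, Var N t v -> vartype v \notin U) ->
    places N' = places N `|` places M ->
    trans N' = trans N `|` trans M ->
    pt N' = pt N `|` pt M `|` [set (p, t)] ->
    tp N' = tp N `|` tp M `|` [set (t, p)] ->
    (forall q, places N q -> alpha N' q = alpha N q) ->
    (forall q, places M q -> alpha N' q = alpha M q) ->
    tJN N'.

(* The projection of N on the set of types U *)
Definition proj_places U N : set P :=
  [set p | places N p /\ {subset (U : seq (label S)) <= alpha N p}].

Definition proj_trans U N : set T :=
  [set t | trans N t /\
    exists2 p, proj_places U N p & pt N (p, t) \/ tp N (t, p)].

Definition restr_vec U (vs : seq (var S)) : seq (var S) :=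
  [seq v <- vs | vartype v \in U].

Definition proj U N : tpnid S P T := {|
  places := proj_places U N;
  trans := proj_trans U N;
  pt := pt N `&` (proj_places U N `*` proj_trans U N);
  tp := tp N `&` (proj_trans U N `*` proj_places U N);
  alpha := fun=> tvec U;
  beta_pt := fun p t => mset_map (restr_vec U) (beta_pt N p t);
  beta_tp := fun t p => mset_map (restr_vec U) (beta_tp N t p) |}.

End TypedJacksonNets.

(* The composition of the nets (Nf k) for k in D, in which transitions are
   shared, whereas a place p of (Nf k) becomes the place (p, k). Renaming the
   places makes the components place-disjoint, so a union of typings and
   inscriptions reads off component k at (p, k). *)
Definition compose (S : signature) (P T K : Type) (D : set K)
    (Nf : K -> tpnid S P T) : tpnid S (P * K) T := {|
  places := [set q | D q.2 /\ places (Nf q.2) q.1];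
  trans := [set t | exists2 k, D k & trans (Nf k) t];
  pt := [set a | D a.1.2 /\ pt (Nf a.1.2) (a.1.1, a.2)];
  tp := [set a | D a.2.2 /\ tp (Nf a.2.2) (a.1, a.2.1)];
  alpha := fun q => alpha (Nf q.2) q.1;
  beta_pt := fun q t => beta_pt (Nf q.2) q.1 t;
  beta_tp := fun t q => beta_tp (Nf q.2) t q.1 |}.

(* The non-empty sets of types occurring in N. A t-JN has finitely many places,
   hence finitely many types, so the finite sets are all the sets. *)
Definition type_sets (S : signature) (P T : Type) (N : tpnid S P T) :
    set {fset (label S)}%fset :=
  [set U | U <> fset0 /\ forall l, l \in U -> types N l].

Definition proj_composition (S : signature) (P T : Type) (N : tpnid S P T) :
    tpnid S (P * {fset (label S)}%fset) T :=
  compose (type_sets N) (fun U => proj U N).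

(* Main.v *)
Require Import Defs.
From mathcomp Require Import all_boot all_order.
From mathcomp Require Import finmap multiset boolp classical_sets.

(** The projection on the set [alpha N p] leaves [p] and its tokens unchanged,
    and this set is one of the sets over which the composition ranges.  The
    copies [(p, alpha N p)] in the composition therefore carry the whole net:
    they determine presets, bindings, enabledness and the successor marking.
    The other copies only hold restrictions of these tokens, and restriction
    commutes with instantiating variables, so they never block a step.  Hence
    sending a marking to all its restrictions is a bisimulation. *)

Set Implicit Arguments.
Unset Strict Implicit.
Unset Printing Implicit Defensive.

Import Order.TTheory.
Local Open Scope fset_scope.

(** * Images of multisets under maps *)

Lemma mset_map_seq_mset (A B : choiceType) (f : A -> B) (s : seq A) :
  mset_map f (seq_mset s) = seq_mset (map f s).
Proof. exact/eq_seq_msetP/perm_map/perm_eq_seq_mset. Qed.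

Lemma mset_map0 (A B : choiceType) (f : A -> B) : mset_map f mset0 = mset0.
Proof.
rewrite /mset_map enum_mset0 /=; apply/msetP => x.
by rewrite mset_seqE mset0E.
Qed.

Lemma msetDr_inj (A : choiceType) (X Y Z : {mset A}%mset) :
  (X `+` Z = Y `+` Z)%mset -> X = Y.
Proof. exact: (can_inj (msetDKBC Z)). Qed.

Lemma seq_mset_cat (A : choiceType) (s1 s2 : seq A) :
  seq_mset (s1 ++ s2) = (seq_mset s1 `+` seq_mset s2)%mset.
Proof. by apply/msetP => x; rewrite msetE2 !mset_seqE count_cat. Qed.

Lemma mset_mapD (A B : choiceType) (f : A -> B) (X Y : {mset A}%mset) :
  mset_map f (X `+` Y)%mset = (mset_map f X `+` mset_map f Y)%mset.
Proof.
rewrite -[X in (X `+` Y)%mset]seq_mset_id -[Y in (_ `+` Y)%mset]seq_mset_id.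
by rewrite -seq_mset_cat mset_map_seq_mset map_cat seq_mset_cat.
Qed.

Lemma mset_map_comp (A B C : choiceType) (g : B -> C) (f : A -> B)
    (X : {mset A}%mset) :
  mset_map g (mset_map f X) = mset_map (g \o f) X.
Proof. by rewrite mset_map_seq_mset -map_comp. Qed.

Lemma mset_map_id_in (A : choiceType) (f : A -> A) (X : {mset A}%mset) :
  {in X, f =1 id} -> mset_map f X = X.
Proof. by move=> fid; rewrite /mset_map map_id_in // seq_mset_id. Qed.

Lemma mset_mapS (A B : choiceType) (f : A -> B) (X Y : {mset A}%mset) :
  (X `<=` Y)%mset -> (mset_map f X `<=` mset_map f Y)%mset.
Proof.
move=> XY; rewrite -(msetBDKC XY) mset_mapD; apply/msubsetP => x.
by rewrite msetE2 leq_addr.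
Qed.

Lemma mset_mapP (A B : choiceType) (f : A -> B) (X : {mset A}%mset) (y : B) :
  reflect (exists2 x, x \in X & y = f x) (y \in mset_map f X).
Proof.
have -> : (y \in mset_map f X) = (y \in map f X).
  by apply: perm_mem; exact: perm_eq_seq_mset.
exact: mapP.
Qed.

(** * Restriction of vectors to a set of types *)

Lemma filter_tvec (S : signature) (U V : {fset (label S)}) :
  {subset (U : seq (label S)) <= tvec V} ->
  [seq l <- tvec V | l \in U] = tvec U.
Proof.
move=> UV; apply: le_sorted_eq.
- by rewrite sorted_filter ?sort_le_sorted //; exact: le_trans.
- exact: sort_le_sorted.
apply: uniq_perm; rewrite ?filter_uniq ?sort_uniq ?fset_uniq // => l.
rewrite mem_filter [in RHS]mem_sort.
by case: (boolP (l \in U)) => // /UV.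
Qed.

(** In place of the condition on each index, this gives an equation of lists, which can be combined
    with [filter_map]. *)
Lemma colourE (S : signature) (P T : Type) (N : tpnid S P T) (p : P)
    (xs : seq (ident S)) :
  colour N p xs <-> [seq idtype x | x <- xs] = alpha N p.
Proof.
split=> [[szE typ]|xsE].
  (* Comparing entries by [nth] needs a default identifier and a default label; a nonempty [xs]
     supplies both. *)
  have [xs0|[x0 x0xs]] : xs = [::] \/ exists x, x \in xs.
    by case: (xs) => [|x s]; [left | right; exists x; rewrite mem_head].
  - by rewrite xs0 /=; apply/esym/nilP; rewrite /nilp -szE xs0.
  apply: (@eq_from_nth _ (idtype x0)); rewrite size_map // => i ilt.
  by rewrite (nth_map x0) //; exact: typ.
rewrite /colour -xsE; split; first by rewrite size_map.
by move=> x0 l0 i ilt; rewrite (nth_map x0).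
Qed.

Definition restr_ids (S : signature) (U : {fset (label S)})
    (xs : seq (ident S)) : seq (ident S) :=
  [seq x <- xs | idtype x \in U].

Lemma restr_vec_id (S : signature) (U : {fset (label S)}) (vs : seq (var S)) :
  {subset [seq vartype v | v <- vs] <= U} -> restr_vec U vs = vs.
Proof.
by move=> sub; apply/all_filterP/allP => v vvs; apply: sub; exact: map_f.
Qed.

Lemma restr_ids_id (S : signature) (U : {fset (label S)}) (xs : seq (ident S)) :
  {subset [seq idtype x | x <- xs] <= U} -> restr_ids U xs = xs.
Proof.
by move=> sub; apply/all_filterP/allP => v vvs; apply: sub; exact: map_f.
Qed.

(** A variable and its value have the same type, so both pass or both fail the test of membership in
    [U]; variables without a value vanish on both sides. *)
Lemma pmap_restr_vec (S : signature) (U : {fset (label S)})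
    (psi : valuation) (vs : seq (var S)) :
  (forall v x, psi v = Some x -> idtype x = vartype v) ->
  pmap psi (restr_vec U vs) = restr_ids U (pmap psi vs).
Proof.
move=> typ; elim: vs => //= v vs IH.
case E: (psi v) => [x|] /=; last by case: ifP => //= _; rewrite E.
by rewrite (typ _ _ E); case: ifP => //= _; rewrite E /= IH.
Qed.

Lemma inst_restr (S : signature) (U : {fset (label S)}) (psi : valuation)
    (X : {mset (seq (var S))}%mset) :
  (forall v x, psi v = Some x -> idtype x = vartype v) ->
  inst psi (mset_map (restr_vec U) X) = mset_map (restr_ids U) (inst psi X).
Proof.
move=> typ; rewrite /inst !mset_map_comp /mset_map; congr seq_mset.
by apply: eq_map => vs /=; exact: pmap_restr_vec.
Qed.

(** Every generation rule records well-formedness of the net it produces, so a case analysis on the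
    last rule suffices. *)
Lemma tJN_wf (S : signature) (P T : Type) (N : tpnid S P T) :
  tJN N -> wf_tpnid N.
Proof. by case. Qed.

Lemma tJN_inscribed (S : signature) (P T : Type) (N : tpnid S P T) :
  tJN N -> jn_inscribed N.
Proof. by case. Qed.

(** * Places and inscriptions of the composition *)

Definition place_types (S : signature) (P T : Type) (N : tpnid S P T) (p : P) :
    {fset (label S)} :=
  [fset l in alpha N p].

Lemma mem_place_types (S : signature) (P T : Type) (N : tpnid S P T) (p : P) :
  place_types N p =i alpha N p.
Proof. by move=> l; rewrite inE. Qed.

Lemma places_compositionE (S : signature) (P T : Type) (N : tpnid S P T)
    (p : P) (U : {fset (label S)}) :
  places (proj_composition N) (p, U) <->
  [/\ places N p, U <> fset0 & {subset (U : seq (label S)) <= alpha N p}].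
Proof.
split=> [[[U0 _] [Np sub]]|[Np U0 sub]]; first by split.
split; last by split.
by split=> // l /sub lp; exists p.
Qed.

(** The composition ranges over nonempty sets only, so a place with empty type would have no copy at
    all. *)
Lemma place_types_composition (S : signature) (P T : Type) (N : tpnid S P T)
    (p : P) :
  (forall q, places N q -> alpha N q <> [::]) -> places N p ->
  places (proj_composition N) (p, place_types N p).
Proof.
move=> ne Np; apply/places_compositionE; split=> //.
  move=> E; have := ne p Np; case El: (alpha N p) => [//|l s] _.
  have : l \in place_types N p by rewrite mem_place_types El mem_head.
  by rewrite E inE.
by move=> l; rewrite mem_place_types.
Qed.

(** No arc at a copy of [p] is lost: an arc between [p] and [t] itself puts [t] into every
    projection that contains [p]. *)
Lemma inscr_pt_composition (S : signature) (P T : Type) (N : tpnid S P T)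
    (p : P) (U : {fset (label S)}) (t : T) :
  wf_tpnid N -> places (proj_composition N) (p, U) ->
  inscr_pt (proj_composition N) (p, U) t =
  mset_map (restr_vec U) (inscr_pt N p t).
Proof.
move=> [wfpt _ _ _] [DU NUp]; rewrite /inscr_pt.
have -> : (((p, U), t) \in pt (proj_composition N)) = ((p, t) \in pt N).
  apply/idP/idP; rewrite !inE; first by case=> _ [].
  move=> Npt; split=> //; split=> //; split=> //.
  by split; [case: (wfpt _ Npt) | exists p => //; left].
by case: ifP => // _; rewrite mset_map0.
Qed.

Lemma inscr_tp_composition (S : signature) (P T : Type) (N : tpnid S P T)
    (p : P) (U : {fset (label S)}) (t : T) :
  wf_tpnid N -> places (proj_composition N) (p, U) ->
  inscr_tp (proj_composition N) t (p, U) =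
  mset_map (restr_vec U) (inscr_tp N t p).
Proof.
move=> [_ wftp _ _] [DU NUp]; rewrite /inscr_tp.
have -> : ((t, (p, U)) \in tp (proj_composition N)) = ((t, p) \in tp N).
  apply/idP/idP; rewrite !inE; first by case=> _ [].
  move=> Ntp; split=> //; split=> //; split=> //.
  by split; [case: (wftp _ Ntp) | exists p => //; right].
by case: ifP => // _; rewrite mset_map0.
Qed.

Lemma inscr_pt_mem (S : signature) (P T : Type) (N : tpnid S P T) (p : P)
    (t : T) (vs : seq (var S)) :
  vs \in inscr_pt N p t -> pt N (p, t) /\ vs \in beta_pt N p t.
Proof. by rewrite /inscr_pt; case: ifP; rewrite ?in_mset0 // inE. Qed.

Lemma inscr_tp_mem (S : signature) (P T : Type) (N : tpnid S P T) (p : P)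
    (t : T) (vs : seq (var S)) :
  vs \in inscr_tp N t p -> tp N (t, p) /\ vs \in beta_tp N t p.
Proof. by rewrite /inscr_tp; case: ifP; rewrite ?in_mset0 // inE. Qed.

Lemma inscr_pt_place_types (S : signature) (P T : Type) (N : tpnid S P T)
    (p : P) (t : T) :
  wf_tpnid N ->
  mset_map (restr_vec (place_types N p)) (inscr_pt N p t) = inscr_pt N p t.
Proof.
move=> [_ _ typ _]; apply: mset_map_id_in => vs vsi.
have [Npt vsb] := inscr_pt_mem vsi.
by apply: restr_vec_id => l; rewrite (typ _ _ Npt) // mem_place_types.
Qed.

Lemma inscr_tp_place_types (S : signature) (P T : Type) (N : tpnid S P T)
    (p : P) (t : T) :
  wf_tpnid N ->
  mset_map (restr_vec (place_types N p)) (inscr_tp N t p) = inscr_tp N t p.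
Proof.
move=> [_ _ _ typ]; apply: mset_map_id_in => vs vsi.
have [Ntp vsb] := inscr_tp_mem vsi.
by apply: restr_vec_id => l; rewrite (typ _ _ Ntp) // mem_place_types.
Qed.

(** Restriction only drops variables, which gives one inclusion; the copies indexed by
    [place_types N p] keep them all, which gives the other. *)
Lemma In_composition (S : signature) (P T : Type) (N : tpnid S P T) (t : T) :
  wf_tpnid N -> (forall p, places N p -> alpha N p <> [::]) ->
  In (proj_composition N) t = In N t.
Proof.
move=> wfN ne; rewrite eqEsubset; split=> v.
  move=> [[p U] [vs [vsi vvs]]]; have [[DU [_ [NUp _]]] _] := inscr_pt_mem vsi.
  have := vsi; rewrite inscr_pt_composition // => /mset_mapP [ws wsi vsE].
  by exists p, ws; split=> //; move: vvs; rewrite vsE mem_filter => /andP [].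
move=> [p [vs [vsi vvs]]]; have [Npt _] := inscr_pt_mem vsi.
have Np : places N p by case: wfN => wfpt _ _ _; case: (wfpt _ Npt).
exists (p, place_types N p), vs; split=> //.
rewrite inscr_pt_composition //; last exact: place_types_composition.
by rewrite inscr_pt_place_types.
Qed.

Lemma Out_composition (S : signature) (P T : Type) (N : tpnid S P T) (t : T) :
  wf_tpnid N -> (forall p, places N p -> alpha N p <> [::]) ->
  Out (proj_composition N) t = Out N t.
Proof.
move=> wfN ne; rewrite eqEsubset; split=> v.
  move=> [[p U] [vs [vsi vvs]]]; have [[DU [_ [_ NUp]]] _] := inscr_tp_mem vsi.
  have := vsi; rewrite inscr_tp_composition // => /mset_mapP [ws wsi vsE].
  by exists p, ws; split=> //; move: vvs; rewrite vsE mem_filter => /andP [].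
move=> [p [vs [vsi vvs]]]; have [Ntp _] := inscr_tp_mem vsi.
have Np : places N p by case: wfN => _ wftp _ _; case: (wftp _ Ntp).
exists (p, place_types N p), vs; split=> //.
rewrite inscr_tp_composition //; last exact: place_types_composition.
by rewrite inscr_tp_place_types.
Qed.

(** * Restricted markings *)

Definition restr_marking (S : signature) (P T : Type) (N : tpnid S P T)
    (m : P -> {mset (seq (ident S))}%mset)
    (q : P * {fset (label S)}) : {mset (seq (ident S))}%mset :=
  if `[< places (proj_composition N) q >] then
    mset_map (restr_ids q.2) (m q.1)
  else mset0.

Lemma restr_markingE (S : signature) (P T : Type) (N : tpnid S P T)
    (m : P -> {mset (seq (ident S))}%mset) (p : P) (U : {fset (label S)}) :
  places (proj_composition N) (p, U) ->
  restr_marking N m (p, U) = mset_map (restr_ids U) (m p).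
Proof. by move=> /asboolP Np; rewrite /restr_marking Np. Qed.

Lemma restr_marking_place_types (S : signature) (P T : Type)
    (N : tpnid S P T) (m : P -> {mset (seq (ident S))}%mset) (p : P) :
  (forall q, places N q -> alpha N q <> [::]) -> places N p ->
  is_marking N m -> restr_marking N m (p, place_types N p) = m p.
Proof.
move=> ne Np mP; rewrite restr_markingE; last exact: place_types_composition.
apply: mset_map_id_in => xs /mP [_ /colourE xsE].
by apply: restr_ids_id => l; rewrite xsE mem_place_types.
Qed.

(** Off the places of the composition, the value [mset0] in [restr_marking] ensures that there are
    no tokens. On them, [alpha N p] is some [tvec V], and filtering it by [U] yields exactly
    [tvec U], the type of the copy. *)
Lemma is_marking_restr (S : signature) (P T : Type) (N : tpnid S P T)
    (m : P -> {mset (seq (ident S))}%mset) :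
  jn_inscribed N -> is_marking N m ->
  is_marking (proj_composition N) (restr_marking N m).
Proof.
move=> [tvecN _ _] mP [p U] xs; rewrite /restr_marking.
case: asboolP => [NUp|]; last by rewrite in_mset0.
move=> /mset_mapP [ys ysm ->]; split=> //; apply/colourE => /=.
have [Np _ sub] := (places_compositionE _ _ _).1 NUp.
have [_ /colourE ysE] := mP _ _ ysm.
have [V VE] := tvecN _ Np.
by rewrite -(@filter_tvec _ U V) -?VE // -ysE filter_map.
Qed.

Lemma Id_restr_marking (S : signature) (P T : Type) (N : tpnid S P T)
    (m : P -> {mset (seq (ident S))}%mset) :
  (forall p, places N p -> alpha N p <> [::]) -> is_marking N m ->
  Id (restr_marking N m) = Id m.
Proof.
move=> ne mP; rewrite eqEsubset; split=> x.
  move=> [[p U] [xs [xsm xxs]]]; move: xsm; rewrite /restr_marking.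
  case: asboolP => [_|_]; last by rewrite in_mset0.
  move=> /mset_mapP [ys ysm xsE]; exists p, ys; split=> //.
  by move: xxs; rewrite xsE mem_filter => /andP [].
move=> [p [xs [xsm xxs]]]; have [Np _] := mP _ _ xsm.
by exists (p, place_types N p), xs; rewrite restr_marking_place_types.
Qed.

(** * The firing rule in the composition *)

Lemma is_binding_composition (S : signature) (P T : Type) (N : tpnid S P T)
    (t : T) (m : P -> {mset (seq (ident S))}%mset) (psi : valuation) :
  wf_tpnid N -> (forall p, places N p -> alpha N p <> [::]) ->
  is_marking N m ->
  is_binding (proj_composition N) t (restr_marking N m) psi <->
  is_binding N t m psi.
Proof.
move=> wfN ne mP.
by rewrite /is_binding /Var /Emit Id_restr_marking // In_composition //
  Out_composition.
Qed.

(** At the copy [(p, place_types N p)] the inequality is the original one for [p]; at any other copy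
    it is the image of that inequality under restriction, which is monotone. *)
Lemma enabled_composition (S : signature) (P T : Type) (N : tpnid S P T)
    (t : T) (m : P -> {mset (seq (ident S))}%mset) (psi : valuation) :
  wf_tpnid N -> (forall p, places N p -> alpha N p <> [::]) ->
  is_marking N m ->
  (forall v x, psi v = Some x -> idtype x = vartype v) ->
  enabled (proj_composition N) t psi (restr_marking N m) <->
  enabled N t psi m.
Proof.
move=> wfN ne mP typ; split=> en.
  move=> p Npt.
  have [Np Nt] : places N p /\ trans N t.
    by case: wfN => wfpt _ _ _; case: (wfpt _ Npt).
  have Np' := place_types_composition ne Np.
  have := en (p, place_types N p).
  rewrite inscr_pt_composition // inscr_pt_place_types //.
  rewrite restr_marking_place_types //; apply.
  case: Np' => DU NUp; split=> //; split=> //; split=> //.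
  by split=> //; exists p => //; left.
move=> [p U] [DU [Npt [NUp _]]].
rewrite inscr_pt_composition // inst_restr // restr_markingE //.
by apply: mset_mapS; exact: en.
Qed.

(** A projection keeps only transitions adjacent to one of its places, so an isolated transition
    would disappear from the composition. *)
Lemma trans_composition (S : signature) (P T : Type) (N : tpnid S P T) (t : T) :
  wf_tpnid N -> (forall p, places N p -> alpha N p <> [::]) ->
  (forall u, trans N u -> exists p, pt N (p, u) \/ tp N (u, p)) ->
  trans (proj_composition N) t <-> trans N t.
Proof.
move=> [wfpt wftp _ _] ne noiso; split; first by case=> U _ [].
move=> Nt; have [p arc] := noiso _ Nt.
have Np : places N p.
  by case: arc => [/wfpt [] | /wftp []].
have [DU NUp] := place_types_composition ne Np.
by exists (place_types N p) => //; split=> //; exists p.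
Qed.

Lemma inscr_pt_off_places (S : signature) (P T : Type) (N : tpnid S P T)
    (p : P) (t : T) : wf_tpnid N -> ~ places N p -> inscr_pt N p t = mset0.
Proof.
move=> [wfpt _ _ _] Np; rewrite /inscr_pt; case: ifP => //.
by rewrite inE => /wfpt [].
Qed.

Lemma inscr_tp_off_places (S : signature) (P T : Type) (N : tpnid S P T)
    (p : P) (t : T) : wf_tpnid N -> ~ places N p -> inscr_tp N t p = mset0.
Proof.
move=> [_ wftp _ _] Np; rewrite /inscr_tp; case: ifP => //.
by rewrite inE => /wftp [].
Qed.

Lemma marking_off_places (S : signature) (P T : Type) (N : tpnid S P T)
    (m : P -> {mset (seq (ident S))}%mset) (p : P) :
  is_marking N m -> ~ places N p -> m p = mset0.
Proof.
move=> mP Np; have [//|[xs /mP [Np' _]]] := mset_0Vmem (m p).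
by case: Np.
Qed.

(** This makes inscriptions of the composition vanish off its places, where the firing equation must
    hold as well. *)
Lemma wf_composition (S : signature) (P T : Type) (N : tpnid S P T) :
  wf_tpnid N -> jn_inscribed N -> wf_tpnid (proj_composition N).
Proof.
move=> [wfpt wftp typt typ] [tvecN _ _].
have restrE p (U : {fset (label S)}) (vs : seq (var S)) : places N p ->
    {subset (U : seq (label S)) <= alpha N p} ->
    [seq vartype v | v <- vs] = alpha N p ->
    [seq vartype v | v <- restr_vec U vs] = tvec U.
  move=> /tvecN [V VE] sub vsE.
  by rewrite -(@filter_tvec _ U V) -?VE // -vsE filter_map.
split.
- by move=> [[p U] t] /= [DU [_ [NUp NUt]]]; split=> //; exists U.
- by move=> [t [p U]] /= [DU [_ [NUt NUp]]]; split=> //; exists U.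
- move=> [p U] t [DU [Npt [[Np sub] _]]] _ /mset_mapP [vs vsb ->].
  by apply: restrE Np sub _; exact: typt vsb.
- move=> [p U] t [DU [Ntp [_ [Np sub]]]] _ /mset_mapP [vs vsb ->].
  by apply: restrE Np sub _; exact: typ vsb.
Qed.

(** Restriction is additive and commutes with instantiation, so it maps the firing equation at [p]
    to the one at each copy of [p]. Off the places of the composition all four terms are empty. *)
Lemma fires_restr (S : signature) (P T : Type) (N : tpnid S P T)
    (m : P -> {mset (seq (ident S))}%mset)
    (m' : P -> {mset (seq (ident S))}%mset) (t : T) (psi : valuation) :
  wf_tpnid N -> jn_inscribed N ->
  (forall v x, psi v = Some x -> idtype x = vartype v) ->
  (forall p, m' p `+` inst psi (inscr_pt N p t) =
             m p `+` inst psi (inscr_tp N t p))%mset ->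
  forall q, (restr_marking N m' q `+`
               inst psi (inscr_pt (proj_composition N) q t) =
             restr_marking N m q `+`
               inst psi (inscr_tp (proj_composition N) t q))%mset.
Proof.
move=> wfN jnN typ eqm [p U]; have wfN' := wf_composition wfN jnN.
have [NUp|NUp] := pselect (places (proj_composition N) (p, U)).
  rewrite !restr_markingE // inscr_pt_composition // inscr_tp_composition //.
  by rewrite !inst_restr // -!mset_mapD eqm.
rewrite inscr_pt_off_places // inscr_tp_off_places //.
by rewrite /restr_marking; case: asboolP.
Qed.

(** * The bisimulation *)

Theorem theorem3 (S : signature) (P T : Type) (N : tpnid S P T)
    (var_bij : bijective (@vartype S))
    (N_tJN : tJN N)
    (types_nonempty : forall p : P, places N p -> alpha N p <> [::])
    (no_isolated : forall t : T, trans N t ->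
       exists p : P, pt N (p, t) \/ tp N (t, p)) :
  let N' := proj_composition N in
  rooted_bisimilar (Gamma (empty_marking N)) (Gamma (empty_marking N')).
Proof.
move=> N'; have wfN := tJN_wf N_tJN; have jnN := tJN_inscribed N_tJN.
exists (fun (m : marking N) (m' : marking N') =>
          sval m' = restr_marking N (sval m)).
  apply/funext => q /=; rewrite /restr_marking.
  by case: ifP => // _; rewrite mset_map0.
move=> [m1 m1P] [m1' m1'P] /= m1E; subst m1'.
split=> [[t psi] [m2 m2P] [Nt bnd en eqm]|[t psi] [m2' m2'P] [Nt bnd en eqm]].
  have [_ _ typ _] := bnd.
  exists (exist _ _ (is_marking_restr jnN m2P)) => //; split=> /=.
  - exact/trans_composition.
  - exact/is_binding_composition.
  - exact/enabled_composition.
  - exact: fires_restr.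
have [_ _ typ _] := bnd; rewrite /= in eqm en bnd.
(* The matching successor in [N] is read off the copies that keep whole tokens. *)
pose m2 p := if `[< places N p >] then m2' (p, place_types N p) else mset0.
have m2P : is_marking N m2.
  move=> p xs; rewrite /m2; case: asboolP => [Np|_]; last by rewrite in_mset0.
  move=> /m2'P [_ /colourE /= xsE]; split=> //; apply/colourE.
  have [tvecN _ _] := jnN; have [V VE] := tvecN _ Np.
  (* The copy is typed by the sorted vector of [place_types N p]. It equals [alpha N p], because
     [alpha N p] is some [tvec V] and filtering it by its own elements changes nothing. *)
  rewrite xsE -(@filter_tvec _ _ V) -VE; last first.
    by move=> l; rewrite mem_place_types.
  by apply/all_filterP/allP => l; rewrite mem_place_types.
have eqm2 p : (m2 p `+` inst psi (inscr_pt N p t) =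
               m1 p `+` inst psi (inscr_tp N t p))%mset.
  rewrite /m2; case: asboolP => Np.
    have Np' := place_types_composition types_nonempty Np.
    have := eqm (p, place_types N p).
    rewrite inscr_pt_composition // inscr_tp_composition //.
    rewrite inscr_pt_place_types // inscr_tp_place_types //.
    by rewrite restr_marking_place_types.
  rewrite inscr_pt_off_places // inscr_tp_off_places //.
  by rewrite (marking_off_places m1P).
exists (exist _ m2 m2P) => /=.
  split=> //=.
  - exact/(trans_composition t wfN types_nonempty no_isolated).
  - exact/(is_binding_composition t psi wfN types_nonempty m1P).
  - exact/(enabled_composition t wfN types_nonempty m1P typ).
(* The marking [m2'] and the restriction of [m2] satisfy the same firing equation from the
   restriction of [m1]; cancelling the consumed tokens shows that they agree at every copy. *)
apply/funext => q; apply: (@msetDr_inj _ _ _ (inst psi (inscr_pt N' q t))).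
by rewrite eqm -(fires_restr wfN jnN typ eqm2).
Qed.
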